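(* Let $\lambda\in\check P$ be a coweight, and let $\alpha,\beta$ be two positive roots in $\Phi$. (1) If $\langle\alpha,\check\beta\rangle=0$, then $R_\alpha R_\beta(\lambda)=R_\beta R_\alpha(\lambda)$. (2) If $\langle\alpha,\check\beta\rangle=-1$, $\langle\beta,\check\alpha\rangle=-1$, and $\lambda\notin H_{\alpha+\beta,-1}$, then $R_\alpha R_\beta R_\alpha(\lambda)=R_\beta R_\alpha R_\beta(\lambda)$. (3) If $\langle\alpha,\check\beta\rangle=-1$, $\langle\beta,\check\alpha\rangle=-2$, and $\lambda$ does not lie in any of the hyperplanes $H_{\alpha+\beta,-1}$, $H_{2\alpha+\beta,-1}$, $H_{2\alpha+\beta,-2}$, then $R_\alpha R_\beta R_\alpha R_\beta(\lambda)=R_\beta R_\alpha R_\beta R_\alpha(\lambda)$.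
   Context: $\Phi$ is the root system of a simple algebraic group $G$ over $\mathbb{C}$ of adjoint type (with respect to a maximal torus $T$), $\Phi^+$ a system of positive roots, $\check\alpha$ the coroot of $\alpha\in\Phi$, $s_\alpha$ the corresponding reflection, $\check P=X_*(T)$ the coweight lattice, $\langle\cdot,\cdot\rangle$ the natural pairing between coweights and roots. For $\alpha\in\Phi^+$ and $k\in\mathbb{Z}$, $H_{\alpha,k}=\{\lambda\in\check P:\langle\lambda,\alpha\rangle=k\}$. For $\alpha\in\Phi^+$ the operator $R_\alpha:\check P\to\check P$ is defined by $R_\alpha(\lambda)=s_\alpha(\lambda)=\lambda-\langle\lambda,\alpha\rangle\check\alpha$ if $\langle\lambda,\alpha\rangle\ge0$, and $R_\alpha(\lambda)=s_\alpha(\lambda)-\check\alpha$ if $\langle\lambda,\alpha\rangle<0$. *)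

(* Defs.v *)
From HB Require Import structures.
From mathcomp Require Import all_boot all_order all_algebra.
From mathcomp Require Import finmap.

Set Implicit Arguments.
Unset Strict Implicit.
Unset Printing Implicit Defensive.

Import Order.TTheory GRing.Theory Num.Theory.
Local Open Scope ring_scope.

Definition free_of_finite_rank (X : zmodType) : Prop :=
  exists (n : nat) (b : 'I_n -> X),
    forall x : X, exists! c : {ffun 'I_n -> int}, x = \sum_i b i *~ c i.

(* The root datum (X^*(T), Phi, X_*(T), Phi^vee) of a reductive group with
   maximal torus T. Here X is the character lattice X^*(T) and Y the cocharacter
   lattice X_*(T); the pairing takes its Y argument first, so that
   [pairing D l a] is <l, a>, and <a, b^vee> is [pairing D (coroot D b) a].
   [coroot] is a total function on X, but only its values on [roots] are
   constrained; the set of coroots is the image of [roots] under it. *)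
Record root_datum (X Y : zmodType) : Type := RootDatum {
  pairing : Y -> X -> int;
  roots : {fset X};
  coroot : X -> Y;
  character_free : free_of_finite_rank X;
  cocharacter_free : free_of_finite_rank Y;
  pairingDl : forall (l m : Y) (x : X),
    pairing (l + m) x = pairing l x + pairing m x;
  pairingDr : forall (l : Y) (x y : X),
    pairing l (x + y) = pairing l x + pairing l y;
  pairing_perfectl : forall f : {additive X -> int},
    exists! l : Y, forall x, pairing l x = f x;
  pairing_perfectr : forall f : {additive Y -> int},
    exists! x : X, forall l, pairing l x = f l;
  coroot_inj : {in roots &, injective coroot};
  pairing_coroot : forall a, a \in roots -> pairing (coroot a) a = 2;
  roots_stable : forall a b, a \in roots -> b \in roots ->
    b - a *~ pairing (coroot a) b \in roots;
  coroots_stable : forall a b, a \in roots -> b \in roots ->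
    exists2 c, c \in roots &
      coroot c = coroot b - coroot a *~ pairing (coroot b) a
}.

Section RootDatum.
Context {X Y : zmodType}.
Implicit Types (D : root_datum X Y) (a b : X) (l : Y).

(* The only roots in the rational line spanned by a root a are a and -a. *)
Definition reduced D : Prop :=
  forall a b, a \in roots D -> b \in roots D ->
    forall m n : int, n != 0 -> b *~ n = a *~ m -> b = a \/ b = - a.

Definition irreducible D : Prop :=
  roots D != fset0 /\
  forall A B : {fset X},
    (A `|` B)%fset = roots D -> (A `&` B)%fset = fset0 ->
    (forall a b, a \in A -> b \in B -> pairing D (coroot D b) a = 0) ->
    A = fset0 \/ B = fset0.

(* X is the root lattice; hence Y is the full coweight lattice. *)
Definition adjoint D : Prop :=
  forall x : X, exists c : X -> int, x = \sum_(a <- roots D) a *~ c a.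

(* The root data of simple groups of adjoint type over an algebraically closed
   field. *)
Definition simple_adjoint D : Prop :=
  [/\ reduced D, irreducible D & adjoint D].

Definition positive_system D (Phip : {fset X}) : Prop :=
  [/\ {subset Phip <= roots D},
      forall a, a \in roots D -> (- a \in Phip) = (a \notin Phip)
    & forall a b, a \in Phip -> b \in Phip -> a + b \in roots D ->
        a + b \in Phip].

Definition hyperplane D a (k : int) : {pred Y} :=
  [pred l | pairing D l a == k].

(* The action of s_a on the coweight lattice. *)
Definition coreflection D a l : Y := l - coroot D a *~ pairing D l a.

Definition R_op D a l : Y :=
  if 0 <= pairing D l a then coreflection D a l
  else coreflection D a l - coroot D a.

End RootDatum.

(* Main.v *)
Require Import Defs.
From HB Require Import structures.
From mathcomp Require Import all_boot all_order all_algebra.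
From mathcomp Require Import finmap.
From mathcomp Require Import zify ring.

(**
  Writing [c = k] for [k >= 0] and [c = k + 1] for [k < 0], where
  [k = <lambda, alpha>], one has [R_alpha lambda = lambda - c alpha^vee]. Hence
  both sides of each identity have the form
  [lambda - p alpha^vee - q beta^vee], where [p] and [q] depend only on
  [<lambda, alpha>], [<lambda, beta>] and the two Cartan integers, and comparing
  them is piecewise linear integer arithmetic. In (1) the second Cartan integer
  [n] vanishes as well: otherwise [s_alpha s_beta] would have infinite order,
  translating [beta + k alpha] to [beta + (k - 2n) alpha] under its square.
*)

Set Implicit Arguments.
Unset Strict Implicit.
Unset Printing Implicit Defensive.

Import Order.TTheory GRing.Theory Num.Theory.
Local Open Scope ring_scope.

Section RootDatumTheory.
Context {X Y : zmodType}.
Variable D : root_datum X Y.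
Implicit Types (a b x : X) (l m : Y).

(** The arguments are swapped so that additivity in the coweight can be registered as a morphism
    instance. *)
Definition pairing_with x l : int := pairing D l x.

Lemma pairing_with_additive x : zmod_morphism (pairing_with x).
Proof.
by move=> l m; rewrite /pairing_with; apply/eqP; rewrite eq_sym subr_eq -pairingDl subrK.
Qed.

Lemma pairing_additive l : zmod_morphism (pairing D l).
Proof.
by move=> x y; apply/eqP; rewrite eq_sym subr_eq -pairingDr subrK.
Qed.

HB.instance Definition _ x :=
  GRing.isZmodMorphism.Build Y int (pairing_with x) (pairing_with_additive x).
HB.instance Definition _ l :=
  GRing.isZmodMorphism.Build X int (pairing D l) (pairing_additive l).

Lemma pairingMzl l x (k : int) : pairing D (l *~ k) x = pairing D l x * k.
Proof. by rewrite -/(pairing_with x _) raddfMz -mulrzr intz. Qed.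

Lemma pairingMzr l x (k : int) : pairing D l (x *~ k) = pairing D l x * k.
Proof. by rewrite raddfMz -mulrzr intz. Qed.

Lemma pairingBl l m x : pairing D (l - m) x = pairing D l x - pairing D m x.
Proof. exact: (raddfB (pairing_with x)). Qed.

(** Apply [s_b], [s_a], [s_b], [s_a] in turn, tracking the coordinates [(e, j)] of
    [b *~ e + a *~ j]: as [s_b] fixes [a], it only flips [e], while [s_a] sends [j] to
    [- j - n * e]. *)
Lemma orthogonal_string_step a b (k : int) :
    a \in Defs.roots D -> b \in Defs.roots D -> pairing D (coroot D b) a = 0 ->
  b + a *~ k \in Defs.roots D ->
  b + a *~ (k - pairing D (coroot D a) b *+ 2) \in Defs.roots D.
Proof.
move=> ra rb ba0; set n := pairing D (coroot D a) b.
have reflb (e j : int) : b *~ e + a *~ j \in Defs.roots D ->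
    b *~ (- e) + a *~ j \in Defs.roots D.
  move=> /(roots_stable rb).
  rewrite pairingDr !pairingMzr pairing_coroot // ba0 mul0r addr0 addrAC.
  by rewrite -mulrzBr; have -> : e - 2 * e = - e by ring.
have refla (e j : int) : b *~ e + a *~ j \in Defs.roots D ->
    b *~ e + a *~ (- j - n * e) \in Defs.roots D.
  move=> /(roots_stable ra).
  rewrite pairingDr !pairingMzr pairing_coroot // -/n -addrA -mulrzBr.
  by have -> : j - (n * e + 2 * j) = - j - n * e by ring.
(* The coordinates run through [(1, k)], [(-1, k)], [(-1, n - k)], [(1, n - k)], [(1, k - 2n)]. *)
rewrite -{1}[b]mulr1z => /reflb/refla/reflb/refla.
rewrite opprK mulr1z.
by have -> : - (- k - n * -1) - n * 1 = k - n *+ 2 by ring.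
Qed.

Lemma pairing_coroot_eq0 a b :
    a \in Defs.roots D -> b \in Defs.roots D ->
  pairing D (coroot D b) a = 0 -> pairing D (coroot D a) b = 0.
Proof.
move=> ra rb ba0; set n := pairing D (coroot D a) b.
pose f (i : nat) := b + a *~ (- (n *+ 2 *+ i)).
have rf i : f i \in Defs.roots D.
  elim: i => [|i IHi]; first by rewrite /f mulr0n oppr0 mulr0z addr0.
  by rewrite /f mulrSr opprD; apply: orthogonal_string_step.
apply/eqP/negPn/negP => n0.
(* Pairing [f i] with the coroot of [a] gives [n - 4ni], which determines [i] when [n] is nonzero;
   one more term than there are roots is then absurd. *)
have f_inj : injective f.
  move=> i j /(congr1 (pairing D (coroot D a))).
  by rewrite !pairingDr !pairingMzr pairing_coroot // -/n; nia.
pose s := [seq f i | i <- iota 0 (#|` Defs.roots D|).+1].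
have : (size s <= size (Defs.roots D))%N.
  apply: uniq_leq_size; first by rewrite map_inj_uniq ?iota_uniq.
  by move=> _ /mapP[i _ ->].
by rewrite size_map size_iota ltnn.
Qed.

Definition R_shift (k : int) : int := if 0 <= k then k else k + 1.

Lemma R_shiftP (k : int) :
  0 <= k /\ R_shift k = k \/ k < 0 /\ R_shift k = k + 1.
Proof. by rewrite /R_shift; case: (lerP 0 k) => ?; [left | right]. Qed.

Lemma R_opE a l : R_op D a l = l - coroot D a *~ R_shift (pairing D l a).
Proof.
rewrite /R_op /R_shift /coreflection; case: ifP => // _.
by rewrite mulrzDr mulr1z opprD addrA.
Qed.

Section Rank2.
Variables (a b : X) (l : Y).

(** Both operators preserve this form and each changes one coefficient, so words in them act on
    pairs [(p, q)]. *)
Definition rank2 (p q : int) : Y := l - coroot D a *~ p - coroot D b *~ q.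

Lemma R_op_rank2l p q : a \in Defs.roots D ->
  R_op D a (rank2 p q) =
  rank2 (p + R_shift (pairing D l a - 2 * p - pairing D (coroot D b) a * q)) q.
Proof.
move=> ra; rewrite R_opE /rank2 !pairingBl !pairingMzl pairing_coroot //.
by rewrite addrAC mulrzDr opprD addrA.
Qed.

Lemma R_op_rank2r p q : b \in Defs.roots D ->
  R_op D b (rank2 p q) =
  rank2 p (q + R_shift (pairing D l b - pairing D (coroot D a) b * p - 2 * q)).
Proof.
move=> rb; rewrite R_opE /rank2 !pairingBl !pairingMzl pairing_coroot //.
by rewrite mulrzDr opprD addrA.
Qed.

End Rank2.

End RootDatumTheory.

(** Innermost shifts go first, so each nested argument is already linear in fresh variables when its
    turn comes. *)
Ltac generalize_R_shift :=
  repeat match goal with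
  | |- context [R_shift ?k] =>
    lazymatch k with
    | context [R_shift _] => fail
    | _ => have := R_shiftP k; move: (R_shift k) => ? ?
    end
  end.

Theorem proposition4p14 (X Y : zmodType) (D : root_datum X Y)
    (hD : simple_adjoint D)
    (Phip : {fset X}) (hPhip : positive_system D Phip)
    (lambda : Y) (alpha beta : X)
    (halpha : alpha \in Phip) (hbeta : beta \in Phip) :
  (pairing D (coroot D beta) alpha = 0 ->
     R_op D alpha (R_op D beta lambda) = R_op D beta (R_op D alpha lambda))
  /\
  (pairing D (coroot D beta) alpha = -1 ->
   pairing D (coroot D alpha) beta = -1 ->
   lambda \notin hyperplane D (alpha + beta) (-1) ->
     R_op D alpha (R_op D beta (R_op D alpha lambda)) =
     R_op D beta (R_op D alpha (R_op D beta lambda)))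
  /\
  (pairing D (coroot D beta) alpha = -1 ->
   pairing D (coroot D alpha) beta = -2 ->
   lambda \notin hyperplane D (alpha + beta) (-1) ->
   lambda \notin hyperplane D (alpha *+ 2 + beta) (-1) ->
   lambda \notin hyperplane D (alpha *+ 2 + beta) (-2) ->
     R_op D alpha (R_op D beta (R_op D alpha (R_op D beta lambda))) =
     R_op D beta (R_op D alpha (R_op D beta (R_op D alpha lambda)))).
Proof.
have [sub_roots _ _] := hPhip.
have [ra rb] := (sub_roots _ halpha, sub_roots _ hbeta).
have -> : lambda = rank2 D alpha beta lambda 0 0.
  by rewrite /rank2 !mulr0z !subr0.
rewrite !(R_op_rank2l, R_op_rank2r) //.
rewrite !inE /rank2 !mulr0z !subr0 -/(rank2 D alpha beta lambda _ _).
(* The hyperplane conditions become linear disequalities in the two pairings of [lambda]. *)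
rewrite !(mulr2n, pairingDr).
move: (pairing D lambda alpha) (pairing D lambda beta) => x y.
split=> [ba0|].
  rewrite ba0 (pairing_coroot_eq0 ra rb ba0).
  congr (_ - _ *~ _ - _ *~ _); generalize_R_shift; lia.
(* Equality of the coefficients suffices; the excluded hyperplanes enter [lia] as hypotheses. *)
split=> -> -> *; congr (_ - _ *~ _ - _ *~ _); generalize_R_shift; lia.
Qed.
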